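(* Let $R$ be a ring, $M$ an $R$-module, $S$ a multiplicatively closed subset of $R$ and $I$ an ideal of $R$ with $I\cap S=\emptyset$. Suppose $N$ is a proper submodule of $M$ such that $IM\subseteq N$. Consider the statements: (1) $I(+)N$ is an $S(+)0$-$1$-absorbing primary ideal of $R(+)M$. (2) $I(+)N$ is an $S(+)M$-$1$-absorbing primary ideal of $R(+)M$. (3) $I$ is an $S$-$1$-absorbing primary ideal of $R$. Then (1) implies (2), and (2) implies (3).
   Context: All rings are commutative with non-zero identity and all modules are unital. The idealization $R(+)M$ is the commutative ring $\{(r,m)\mid r\in R,\ m\in M\}$ with componentwise addition and multiplication $(r_1,m_1)(r_2,m_2)=(r_1r_2,\,r_1m_2+r_2m_1)$. For subsets $X\subseteq R$ and $Y\subseteq M$, $X(+)Y=\{(x,y)\mid x\in X,\ y\in Y\}$; $I(+)N$ is an ideal of $R(+)M$ when $IM\subseteq N$, and $S(+)0=\{(s,0)\mid s\in S\}$ and $S(+)M=\{(s,m)\mid s\in S, m\in M\}$ are multiplicatively closed subsets of $R(+)M$. For a multiplicatively closed subset $S$ of a ring $R$, a proper ideal $I$ of $R$ with $I\cap S=\emptyset$ is called $S$-$1$-absorbing primary if there exists a fixed $s\in S$ such that for all non-unit $a,b,c\in R$, if $abc\in I$, then $sab\in I$ or $sc\in\sqrt{I}$. *)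

(* Defs.v *)
From HB Require Import structures.
From mathcomp Require Import all_boot all_order all_algebra.
From mathcomp Require Import boolp classical_sets.

Set Implicit Arguments.
Unset Strict Implicit.
Unset Printing Implicit Defensive.

Import GRing.Theory.
Local Open Scope ring_scope.
Local Open Scope classical_set_scope.

(* A named copy of [R * M]: the additive structure is that of the product, but
   the multiplication is not componentwise. *)
Definition idealization (R : comNzRingType) (M : lmodType R) : Type :=
  (R * M)%type.

Section Idealization.
Variables (R : comNzRingType) (M : lmodType R).

HB.instance Definition _ := GRing.Zmodule.copy (idealization M) (R * M)%type.

Definition idealization_one : idealization M := (1, 0).

Definition idealization_mul (x y : idealization M) : idealization M :=
  (x.1 * y.1, x.1 *: y.2 + y.1 *: x.2).

Fact idealization_mulA : associative idealization_mul.
Proof.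
move=> [a m] [b n] [c p]; congr (_, _) => /=; first exact: mulrA.
rewrite !scalerDr !scalerA addrA (mulrC c a) (mulrC c b).
by [].
Qed.

Fact idealization_mulC : commutative idealization_mul.
Proof.
by move=> [a m] [b n]; congr (_, _) => /=; [exact: mulrC | exact: addrC].
Qed.

Fact idealization_mul1 : left_id idealization_one idealization_mul.
Proof.
by move=> [a m]; rewrite /idealization_mul /= mul1r scale1r scaler0 addr0.
Qed.

Fact idealization_mulDl :
  left_distributive idealization_mul (@GRing.add (idealization M)).
Proof.
move=> [a m] [b n] [c p]; congr (_, _) => /=; first exact: mulrDl.
by rewrite scalerDl scalerDr addrACA.
Qed.

Fact idealization_one_neq0 : idealization_one != 0 :> idealization M.
Proof. by apply/eqP => -[] /eqP; rewrite oner_eq0. Qed.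

HB.instance Definition _ := GRing.Zmodule_isComNzRing.Build (idealization M)
  idealization_mulA idealization_mulC idealization_mul1 idealization_mulDl
  idealization_one_neq0.

(* The subset X(+)Y of R(+)M. *)
Definition idealization_set (X : set R) (Y : set M) : set (idealization M) :=
  X `*` Y.

End Idealization.

Section RingNotions.
Variable R : comNzRingType.
Implicit Types (S I : set R).

(* The ideals of R, the unit ideal included, are the submodules of R^o
   ([idealr_closed] would only cover the proper ones). *)
Definition is_ideal I : Prop := @submod_closed R R^o (mem I).

(* Stated propositionally: [GRing.unit] would require invertibility in R to be
   boolean, that is R : comUnitRingType. *)
Definition invertible (a : R) : Prop := exists b, a * b = 1.

Definition radical I : set R := [set x | exists2 n, (0 < n)%N & I (x ^+ n)].

Definition one_absorbing_primary S I : Prop :=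
  [/\ mulr_closed (mem S), is_ideal I, I `<` setT, I `&` S = set0 &
    exists2 s, S s &
      forall a b c, ~ invertible a -> ~ invertible b -> ~ invertible c ->
        I (a * b * c) -> I (s * a * b) \/ radical I (s * c)].

End RingNotions.

(* IM, the submodule of finite sums of products. *)
Definition ideal_smul (R : comNzRingType) (M : lmodType R) (I : set R) :
    set M :=
  [set x | exists n (a : 'I_n -> R) (m : 'I_n -> M),
    (forall i, I (a i)) /\ x = \sum_(i < n) a i *: m i].
Arguments ideal_smul {R} M I.

(* Main.v *)
Require Import Defs.
From mathcomp Require Import all_boot all_order all_algebra.
From mathcomp Require Import boolp classical_sets.

(** Two independent observations carry the proof.

    For (1) implies (2): the set [S(+)0] is contained in [S(+)M], and an element
    witnessing the absorbing condition for a multiplicative set also witnesses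
    it for any larger one ([one_absorbing_primary_sub]). What remains is that
    [S(+)M] is multiplicatively closed and still avoids [I(+)N]; both can be
    read off the first components.

    For (2) implies (3): the first projection of the idealization onto [R] is a
    ring morphism, and [a |-> (a, 0)] is a multiplicative section of it. The
    section sends non-units to non-units (project an inverse), and sends [I] into
    [I(+)N] since [N] contains 0. So the condition on [I(+)N] applies to
    [(a, 0), (b, 0), (c, 0)], and projecting its conclusion gives the one for
    [I], with the first component of the witness as the new witness. *)

Import GRing.Theory.
Local Open Scope ring_scope.
Local Open Scope classical_set_scope.

Lemma mulr_closed_setP (R : comNzRingType) (S : set R) :
  GRing.mulr_closed (mem S) <-> S 1 /\ forall x y, S x -> S y -> S (x * y).
Proof.
split=> -[S1 SM]; split=> [|x y].
- exact: set_mem S1.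
- by move=> /mem_set Sx /mem_set Sy; apply: set_mem (SM x y Sx Sy).
- exact: mem_set S1.
- by move=> /set_mem Sx /set_mem Sy; apply: mem_set (SM x y Sx Sy).
Qed.

(** The witness for [S] lies in [T], and the absorbing condition mentions the
    multiplicative set only through its witness. *)
Lemma one_absorbing_primary_sub (R : comNzRingType) (S T I : set R) :
  GRing.mulr_closed (mem T) -> S `<=` T -> I `&` T = set0 ->
  one_absorbing_primary S I -> one_absorbing_primary T I.
Proof.
move=> Tmul ST IT0 [_ Iid Iprop _ [s Ss sP]].
by split=> //; exists s => //; apply: ST.
Qed.

Lemma disjoint_proper (R : comNzRingType) (S I : set R) :
  GRing.mulr_closed (mem S) -> I `&` S = set0 -> I `<` setT.
Proof.
move=> /mulr_closed_setP[S1 _] IS0; split=> // TI.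
suff : (I `&` S) 1 by rewrite IS0.
by split=> //; apply: TI.
Qed.

Section FirstProjection.
Variables (R : comNzRingType) (M : lmodType R).

Lemma fst_idealizationX (x : idealization M) n : (x ^+ n).1 = x.1 ^+ n.
Proof. by elim: n => [|n IHn]; rewrite ?expr0 // !exprS -IHn. Qed.

Definition idealization_inl (a : R) : idealization M := (a, 0).

Lemma idealization_inlM (a b : R) :
  idealization_inl a * idealization_inl b = idealization_inl (a * b).
Proof. by congr (_, _); rewrite /= !scaler0 addr0. Qed.

Lemma invertible_fst (x : idealization M) : invertible x -> invertible x.1.
Proof.
by move=> [y xy1]; exists y.1; rewrite -[1]/((1 : idealization M).1) -xy1.
Qed.

Lemma radical_fst (I : set R) (N : set M) (x : idealization M) :
  radical (idealization_set I N) x -> radical I x.1.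
Proof.
by move=> [n n_gt0 [Ixn _]]; exists n => //; rewrite -fst_idealizationX.
Qed.

Lemma idealization_setT_mulr_closed (S : set R) :
  GRing.mulr_closed (mem S) ->
  GRing.mulr_closed (mem (idealization_set S [set: M])).
Proof.
move=> /mulr_closed_setP[S1 SM]; apply/mulr_closed_setP; split=> //.
by move=> x y [Sx _] [Sy _]; split=> //; apply: SM.
Qed.

Lemma idealization_set_disjoint (S I : set R) (N P : set M) :
  I `&` S = set0 -> idealization_set I N `&` idealization_set S P = set0.
Proof.
move=> IS0; apply/seteqP; split=> // x [[Ix _] [Sx _]].
by have : (I `&` S) x.1 by []; rewrite IS0.
Qed.

(** If [(s, m)] is a witness for [I(+)N], then [s] is one for [I]: the first
    component of a product [(s, m) * (a, 0) * (b, 0)] is [s * a * b]. *)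
Lemma one_absorbing_primary_fst (S I : set R) (N P : set M) :
  GRing.mulr_closed (mem S) -> is_ideal I -> I `&` S = set0 -> N 0 ->
  one_absorbing_primary (idealization_set S P) (idealization_set I N) ->
  one_absorbing_primary S I.
Proof.
move=> Smul Iid IS0 N0 [_ _ _ _ [s [Ss _] sP]]; split=> //.
  exact: disjoint_proper IS0.
exists s.1 => // a b c nua nub nuc Iabc.
have nu_inl d : ~ invertible d -> ~ invertible (idealization_inl d).
  by move=> nud /invertible_fst.
have INabc : idealization_set I N
    (idealization_inl a * idealization_inl b * idealization_inl c).
  by rewrite !idealization_inlM.
have [[Isab _]|/radical_fst Isc] :=
  sP _ _ _ (nu_inl _ nua) (nu_inl _ nub) (nu_inl _ nuc) INabc.
- by left.
- by right.
Qed.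

End FirstProjection.

Theorem proposition10 (R : comNzRingType) (M : lmodType R) (S I : set R)
    (N : set M) (hS : GRing.mulr_closed (mem S)) (hI : is_ideal I)
    (hIS : I `&` S = set0) (hN : GRing.submod_closed (mem N))
    (hNproper : N `<` setT) (hIMN : ideal_smul M I `<=` N) :
  (one_absorbing_primary (idealization_set S [set 0 : M])
     (idealization_set I N) ->
   one_absorbing_primary (idealization_set S [set: M])
     (idealization_set I N)) /\
  (one_absorbing_primary (idealization_set S [set: M])
     (idealization_set I N) ->
   one_absorbing_primary S I).
Proof.
split.
  apply: one_absorbing_primary_sub.
  - exact: idealization_setT_mulr_closed.
  - by move=> x [].
  - exact: idealization_set_disjoint.
apply: one_absorbing_primary_fst => //.
by case: hN => /set_mem.
Qed.
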